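(* Let $G$ be a connected ribbon graph with $n$ edges numbered $1,\dots,n$, let $V=\mathbb{F}_2^{2n}$ be the symplectic vector space with basis $e_1,\dots,e_n,f_1,\dots,f_n$ and alternating form determined by $(e_i,f_j)=\delta_{ij}$, $(e_i,e_j)=(f_i,f_j)=0$, and let $L(G)\subset V$ be the $L$-space of $G$. Then $L(G)$ is a Lagrangian (i.e. maximal isotropic) subspace of $V$.
   Context: A ribbon graph $G$ is a compact surface with boundary (possibly non-orientable) represented as the union of two finite sets of closed topological disks, the vertices (pairwise disjoint) and the edges, also called ribbons or chords (pairwise disjoint), such that edges and vertices intersect along disjoint line segments contained in their boundaries, each such segment lies in precisely one edge and one vertex, and each edge contains exactly two such segments. So each edge is a rectangle glued to vertex boundaries along two opposite sides (the attaching sides); its two other sides are the free sides. Ribbon graphs are considered up to homeomorphisms preserving the decomposition into vertices and edges. The punctured ribbon graph $\widehat{G}$ is the compact surface with boundary obtained from $G$ by removing an open disk from the interior of each vertex. For each edge $E_i$, let $\alpha_i$ be an arc inside $E_i$ connecting the two free sides of $E_i$ (crossing the ribbon transversally to its length), and let $\beta_i$ be the arc going lengthwise along $E_i$, leaving $E_i$ through its two attaching sides and continuing inside the adjacent vertices straight to the boundaries of the punctures in these vertices (the two ends may lie in the same vertex). These arcs define classes $[\alpha_i],[\beta_i]\in H_1(\widehat{G},\partial\widehat{G};\mathbb{F}_2)$. Using the $\mathbb{F}_2$-valued intersection pairing $\cap$ between $H_1(\widehat{G};\mathbb{F}_2)$ and $H_1(\widehat{G},\partial\widehat{G};\mathbb{F}_2)$,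 define $$\varphi_G:H_1(\widehat{G};\mathbb{F}_2)\to V,\qquad \varphi_G(\gamma)=\sum_i(\gamma\cap[\alpha_i])\,e_i+\sum_i(\gamma\cap[\beta_i])\,f_i .$$ The $L$-space of $G$ is $L(G):=\operatorname{Im}\varphi_G\subset V$. *)

(* Defs.v *)
From HB Require Import structures.
From mathcomp Require Import all_boot all_order all_algebra.

Set Implicit Arguments.
Unset Strict Implicit.
Unset Printing Implicit Defensive.
Set Warnings "-notation-overridden,-ambiguous-paths".

Import GRing.Theory.
Local Open Scope ring_scope.
Local Open Scope quotient_scope.

(******************************************************************************)
(* Quotient of a finite dimensional vector space by a subspace                *)
(******************************************************************************)

Section QuotientSpace.
Import VectorInternalTheory.
Variables (K : fieldType) (vT : vectType K) (U : {vspace vT}).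

Definition quotv := Quotient.quot U.
HB.instance Definition _ := EqQuotient.on quotv.
HB.instance Definition _ := GRing.Zmodule.on quotv.

Definition piv : vT -> quotv := fun v => \pi_(Quotient.quot U) v.
Definition reprv : quotv -> vT := fun q => @repr _ (Quotient.quot U) q.

Lemma reprvK : cancel reprv piv.
Proof. by move=> q; rewrite /piv /reprv reprK. Qed.

Lemma piv_eq v w : (piv v == piv w) = (v - w \in U).
Proof. by rewrite /piv Quotient.idealrBE. Qed.

Lemma pivD v w : piv (v + w) = piv v + piv w.
Proof. exact: (raddfD (\pi_(Quotient.quot U))). Qed.

Lemma reprv_piv v : reprv (piv v) - v \in U.
Proof. by rewrite -piv_eq reprvK. Qed.

Definition scaleq (a : K) (q : quotv) : quotv := piv (a *: reprv q).

Lemma piv_scale a v : piv (a *: v) = scaleq a (piv v).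
Proof.
apply/eqP; rewrite eq_sym /scaleq piv_eq -scalerBr.
exact: rpredZ (reprv_piv v).
Qed.

Lemma scaleqA a b q : scaleq a (scaleq b q) = scaleq (a * b) q.
Proof. by rewrite -[q]reprvK -!piv_scale scalerA. Qed.

Lemma scale1q : left_id 1 scaleq.
Proof. by move=> q; rewrite -[q]reprvK -piv_scale scale1r. Qed.

Lemma scaleqDr : right_distributive scaleq +%R.
Proof.
move=> a p q; rewrite -[p]reprvK -[q]reprvK.
by rewrite -pivD -!piv_scale -pivD scalerDr.
Qed.

Lemma scaleqDl q : {morph scaleq^~ q : a b / a + b}.
Proof. by move=> a b /=; rewrite -[q]reprvK -!piv_scale -pivD scalerDl. Qed.

HB.instance Definition _ :=
  GRing.Zmodule_isLmodule.Build K quotv scaleqA scale1q scaleqDr scaleqDl.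

Lemma piv_linear : linear piv.
Proof. by move=> a v w; rewrite pivD piv_scale. Qed.

HB.instance Definition _ := GRing.isSemilinear.Build K vT quotv _ piv
  (GRing.semilinear_linear piv_linear).

Lemma piv_eq0 v : (piv v == 0) = (v \in U).
Proof. by rewrite -(raddf0 piv) piv_eq subr0. Qed.

Fact quotv_vect_iso : Vector.axiom (\dim (U^C)) quotv.
Proof.
pose pr v : subvs_of (U^C) := vsproj (U^C) (v - projv U v).
have prE v : vsval (pr v) = v - projv U v by rewrite vsprojK ?memv_projC.
have pr_lin : linear pr.
  move=> a v w; apply: subvs_inj; rewrite linearP /= !prE linearP /=.
  by rewrite opprD addrACA scalerBr.
have pr_pi v : pr (reprv (piv v)) = pr v.
  apply/eqP; rewrite -subr_eq0; apply/eqP/subvs_inj.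
  rewrite linearB linear0 /= !prE opprD addrACA -opprD.
  by rewrite -linearB /= projv_id ?reprv_piv // subrr.
exists (fun q => v2r (pr (reprv q))).
  move=> a p q; rewrite -[RHS](linearP (@v2r _ (subvs_of (U^C)))); apply: congr1.
  by rewrite -pr_lin -[RHS]pr_pi piv_linear !reprvK.
exists (fun r => piv (vsval (r2v r : subvs_of (U^C)))) => [q|r].
  rewrite v2rK -[X in _ = X]reprvK; apply/eqP.
  by rewrite piv_eq prE addrAC subrr add0r memvN memv_proj.
rewrite pr_pi -[RHS]r2vK; apply/congr1/subvs_inj; rewrite prE.
set w := vsval _; apply/eqP; rewrite subr_eq addrC -subr_eq subrr eq_sym.
rewrite -memv0 -(capv_compl U) memv_cap memv_proj /=.
have -> : projv U w = w - (w - projv U w) by rewrite opprB addrCA subrr addr0.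
by rewrite memvB ?memv_projC // subvsP.
Qed.

HB.instance Definition _ := Lmodule_hasFinDim.Build K quotv quotv_vect_iso.

End QuotientSpace.

(******************************************************************************)
(* Cellular chains and homology                                               *)
(******************************************************************************)

Definition F2 : fieldType := 'F_2.

Lemma F2_addxx (x : F2) : x + x = 0.
Proof.
by rewrite -mulr2n -mulr_natr (_ : 2%:R = 0 :> 'F_2) ?mulr0 //; apply: val_inj.
Qed.

#[local] Opaque F2.

Definition chain (T : finType) : vectType F2 := {ffun T -> F2^o}.

Definition cell (T : finType) (t : T) : chain T := [ffun u => (u == t)%:R].

Lemma cellE (T : finType) (t u : T) : cell t u = (u == t)%:R.
Proof. by rewrite ffunE. Qed.

Lemma chainD (T : finType) (z w : chain T) u : (z + w) u = z u + w u.
Proof. by rewrite ffunE. Qed.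

Lemma chain_addxx (T : finType) (z : chain T) : z + z = 0.
Proof. by apply/ffunP => t; rewrite !ffunE F2_addxx. Qed.

Lemma cell_sum2 (T : finType) (t t' u : T) :
  (cell t + cell t') u = (u == t)%:R + (u == t')%:R.
Proof. by rewrite !ffunE. Qed.

Section LinearExtension.
Variables (S T : finType) (f : S -> chain T).

Definition lin_ext_fun (c : chain S) : chain T := \sum_s c s *: f s.

Fact lin_ext_fun_linear : linear lin_ext_fun.
Proof.
move=> a c d; rewrite /lin_ext_fun scaler_sumr -big_split /=.
by apply: eq_bigr => s _; rewrite !ffunE scalerDl scalerA.
Qed.

HB.instance Definition _ := GRing.isSemilinear.Build _ _ _ _ lin_ext_fun
  (GRing.semilinear_linear lin_ext_fun_linear).

Definition lin_ext : 'Hom(chain S, chain T) := linfun lin_ext_fun.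

Lemma lin_extE c : lin_ext c = \sum_s c s *: f s.
Proof. by rewrite lfunE. Qed.

Lemma lin_ext_cell s : lin_ext (cell s) = f s.
Proof.
rewrite lin_extE (bigD1 s) //= ffunE eqxx scale1r big1 ?addr0 // => t ts.
by rewrite ffunE (negbTE ts) scale0r.
Qed.

Lemma lin_ext_cell2 s t : lin_ext (cell s + cell t) = f s + f t.
Proof. by rewrite linearD /= !lin_ext_cell. Qed.

End LinearExtension.

Lemma cell_decomp (T : finType) (c : chain T) : c = \sum_t c t *: cell t.
Proof.
apply/ffunP => u; rewrite sum_ffunE (bigD1 u) //= big1 ?addr0 => [|t tu].
  by rewrite !ffunE eqxx; exact/esym/mulr1.
by rewrite !ffunE eq_sym (negbTE tu); exact: mulr0.
Qed.

Section Homology.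
Variables (K : fieldType) (A B C : vectType K).
Variables (d2 : 'Hom(A, B)) (d1 : 'Hom(B, C)).

Definition cycle_type : vectType K := subvs_of (lker d1).

(* ker d1 / im d2, with im d2 seen as a subspace of ker d1 *)
Definition homology : vectType K :=
  quotv (linfun (vsval : cycle_type -> B) @^-1: limg d2)%VS.

Definition hclass (z : B) (dz : z \in lker d1) : homology :=
  piv _ (Subvs dz : cycle_type).

Definition hrepr (x : homology) : B := vsval (reprv x).

Lemma hrepr_cycle x : hrepr x \in lker d1.
Proof. exact: subvsP. Qed.

Lemma hrepr_class z (dz : z \in lker d1) : hrepr (hclass dz) - z \in limg d2.
Proof.
have := reprv_piv (linfun (vsval : cycle_type -> B) @^-1: limg d2)%VS
  (Subvs dz : cycle_type).
by rewrite -memv_preim lfunE.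
Qed.

Lemma hrepr_linear a x y :
  hrepr (a *: x + y) - (a *: hrepr x + hrepr y) \in limg d2.
Proof.
have := reprv_piv (linfun (vsval : cycle_type -> B) @^-1: limg d2)%VS
  (a *: reprv x + reprv y).
by rewrite -memv_preim lfunE piv_linear !reprvK.
Qed.

End Homology.

(******************************************************************************)
(* Ribbon graphs                                                              *)
(*                                                                            *)
(* A ribbon graph, up to homeomorphisms preserving vertices and edges, is     *)
(* encoded by the way its ribbons are glued to the vertex discs. Ribbon i is  *)
(* the square [0,1] x [0,1] with attaching sides {a} x [0,1] and free sides   *)
(* [0,1] x {s}, for a, s in {0,1}; its four corners are the points (a,s).     *)
(* The corners lie on the boundary circles of the vertices, which they cut    *)
(* alternately into attaching sides and arcs disjoint from the ribbons.       *)
(* No orientation is involved, so non-orientable surfaces are included, and   *)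
(* so are loops, multiple edges and vertices without any ribbon.              *)
(******************************************************************************)

Definition corner (n : nat) : finType := ('I_n * bool * bool)%type.

Record ribbon_graph (n : nat) := RibbonGraph {
  vertex : finType;
  (* the vertex on whose boundary circle a corner lies *)
  base : corner n -> vertex;
  (* the arcs on the boundary circles of the vertices, with their two ends *)
  arc : finType;
  arc_end : arc -> bool -> corner n;
  (* every corner is an end of exactly one arc, and bounds it on one side *)
  arc_end_bij : bijective (fun cb : arc * bool => arc_end cb.1 cb.2);
  (* the corners on the boundary of a vertex lie on a single circle, i.e. *)
  (* one can travel between them along attaching sides and arcs *)
  base_circle : forall x y : corner n,
    (base x == base y) =
    connect (fun x y => (x.1 == y.1) ||
               [exists c : arc, [exists b, (arc_end c b == x) &&
                                           (arc_end c (~~ b) == y)]]) x y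
}.

Definition adjacent n (G : ribbon_graph n) : rel (vertex G) :=
  fun u v => [exists x : corner n, [exists y : corner n,
    [&& x.1.1 == y.1.1, base G x == u & base G y == v]]].

Definition connected n (G : ribbon_graph n) : Prop :=
  (0 < #|vertex G|)%N /\ forall u v : vertex G, connect (@adjacent n G) u v.

(******************************************************************************)
(* Homology of the punctured ribbon graph                                     *)
(*                                                                            *)
(* Two cell structures, dual to each other, are used for the punctured ribbon *)
(* graph X, so that absolute cycles and relative cycles are transverse.       *)
(*                                                                            *)
(* - Absolute: each vertex with its puncture is an annulus, which retracts    *)
(*   onto the boundary circle of the vertex, so X retracts onto the union of  *)
(*   these circles and of the ribbons. The 0-cells are the corners; the       *)
(*   1-cells are the attaching sides, the free sides and the arcs; the        *)
(*   2-cells are the ribbons. The boundary circle of an isolated vertex       *)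
(*   consists of one 0-cell and one 1-cell.                                   *)
(* - Relative to the boundary of X: the 0-cells are the centers of the        *)
(*   ribbons, where alpha_i and beta_i cross; the 1-cells are the two halves  *)
(*   of each alpha_i, the two halves of each beta_i, and for every arc (resp. *)
(*   isolated vertex) a segment from the puncture of the vertex to the middle *)
(*   of the arc (resp. to the boundary of the vertex). They cut X into discs, *)
(*   the 2-cells, one around each corner and one for each isolated vertex.    *)
(*                                                                            *)
(* Each absolute 1-cell crosses exactly one relative 1-cell, exactly once:    *)
(* an attaching (resp. free) side crosses the half of beta_i (resp. alpha_i)  *)
(* that runs from the center of the ribbon through that side. So the 1-cells  *)
(* of both structures are indexed by the same type, likewise the absolute     *)
(* 0-cells and the relative 2-cells, and the absolute 2-cells and the         *)
(* relative 0-cells.                                                          *)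
(******************************************************************************)

Section PuncturedRibbonGraph.
Variables (n : nat) (G : ribbon_graph n).

Definition isolated : finType := {v : vertex G | v \notin codom (base G)}.

Definition cell0 : finType := (corner n + isolated)%type.
Definition cell1 : finType := ('I_n * bool + 'I_n * bool + arc G + isolated)%type.
Definition cell2 : finType := 'I_n.

Definition corner_pt (x : corner n) : cell0 := inl x.
Definition isolated_pt (v : isolated) : cell0 := inr v.

Definition attaching_side (i : 'I_n) (a : bool) : cell1 := inl (inl (inl (i, a))).
Definition free_side (i : 'I_n) (s : bool) : cell1 := inl (inl (inr (i, s))).
Definition arc_side (c : arc G) : cell1 := inl (inr c).
Definition isolated_circle (v : isolated) : cell1 := inr v.

Definition bd1_cell (t : cell1) : chain cell0 :=
  match t with
  | inl (inl (inl (i, a))) =>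
      cell (corner_pt (i, a, false)) + cell (corner_pt (i, a, true))
  | inl (inl (inr (i, s))) =>
      cell (corner_pt (i, false, s)) + cell (corner_pt (i, true, s))
  | inl (inr c) =>
      cell (corner_pt (arc_end c false)) + cell (corner_pt (arc_end c true))
  | inr v => cell (isolated_pt v) + cell (isolated_pt v)
  end.

Definition bd2_cell (i : cell2) : chain cell1 :=
  (cell (attaching_side i false) + cell (attaching_side i true)) +
  (cell (free_side i false) + cell (free_side i true)).

Definition bd1 : 'Hom(chain cell1, chain cell0) := lin_ext bd1_cell.
Definition bd2 : 'Hom(chain cell2, chain cell1) := lin_ext bd2_cell.

Definition H1 : vectType F2 := homology bd2 bd1.

(* The other end of a half of alpha_i or beta_i, and both ends of the other *)
(* relative 1-cells, are on the boundary of the punctured ribbon graph. *)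
Definition rel_bd1_cell (t : cell1) : chain cell2 :=
  match t with
  | inl (inl (inl (i, _))) => cell i
  | inl (inl (inr (i, _))) => cell i
  | inl (inr _) => 0
  | inr _ => 0
  end.

(* The region of an isolated vertex lies on both sides of its segment. *)
Definition rel_bd2_cell (p : cell0) : chain cell1 :=
  match p with
  | inl (i, a, s) =>
      cell (attaching_side i a) + cell (free_side i s) +
      \sum_(c | [exists b, arc_end c b == (i, a, s)]) cell (arc_side c)
  | inr v => cell (isolated_circle v) + cell (isolated_circle v)
  end.

Definition rel_bd1 : 'Hom(chain cell1, chain cell2) := lin_ext rel_bd1_cell.
Definition rel_bd2 : 'Hom(chain cell0, chain cell1) := lin_ext rel_bd2_cell.

Definition H1_rel : vectType F2 := homology rel_bd2 rel_bd1.

(* number of crossings modulo 2 *)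
Definition crossing (T : finType) (z w : chain T) : F2 := \sum_t z t * w t.

Lemma crossing_linear_l (T : finType) (w : chain T) a z z' :
  crossing (a *: z + z') w = a * crossing z w + crossing z' w.
Proof.
rewrite /crossing mulr_sumr -big_split /=; apply: eq_bigr => t _.
by rewrite !ffunE mulrDl mulrA.
Qed.

Lemma crossingC (T : finType) (z w : chain T) : crossing z w = crossing w z.
Proof. by apply: eq_bigr => t _; rewrite mulrC. Qed.

Lemma crossing_cell (T : finType) (z : chain T) t : crossing z (cell t) = z t.
Proof.
rewrite /crossing (bigD1 t) //= big1 ?addr0 ?ffunE ?eqxx ?mulr1 // => u ut.
by rewrite ffunE (negbTE ut) mulr0.
Qed.

Lemma crossing_adj (S T : finType) (f : S -> chain T) (g : T -> chain S) :
    (forall s t, f s t = g t s) ->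
  forall z w, crossing (lin_ext f z) w = crossing z (lin_ext g w).
Proof.
move=> fg z w; rewrite !lin_extE /crossing.
under eq_bigr => t _ do rewrite sum_ffunE mulr_suml.
under [RHS]eq_bigr => s _ do rewrite sum_ffunE mulr_sumr.
rewrite exchange_big; apply: eq_bigr => s _; apply: eq_bigr => t _.
by rewrite !ffunE -fg /= -mulrA [f s t * _]mulrC.
Qed.

Lemma arc_end_inj c c' b b' :
  arc_end c b = arc_end c' b' :> corner n -> (c, b) = (c', b') :> arc G * bool.
Proof. by move=> e; apply: (bij_inj (arc_end_bij G)). Qed.

Lemma bd1_cellE t p :
  bd1_cell t p =
  match t with
  | inl (inl (inl (i, a))) => (p == corner_pt (i, a, false))%:R + (p == corner_pt (i, a, true))%:R
  | inl (inl (inr (i, s))) => (p == corner_pt (i, false, s))%:R + (p == corner_pt (i, true, s))%:R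
  | inl (inr c) => (p == corner_pt (arc_end c false))%:R + (p == corner_pt (arc_end c true))%:R
  | inr v => (p == isolated_pt v)%:R + (p == isolated_pt v)%:R
  end.
Proof. by case: t => [[[[i a]|[i s]]|c]|u]; apply: cell_sum2. Qed.

Lemma arc_cellsE x u :
  (\sum_(c | [exists b, arc_end c b == x]) cell (arc_side c) : chain cell1) u =
  if u is inl (inr c) then [exists b, arc_end c b == x]%:R else 0.
Proof.
rewrite sum_ffunE; case: u => [[u|c]|u]; try by rewrite big1 // => c _; rewrite ffunE.
rewrite big_mkcond (bigD1 c) //= big1 => [|d dc]; last first.
  by case: ifP => // _; rewrite ffunE /eq_op /= /eq_op /= eq_sym (negbTE dc).
by rewrite addr0 ffunE eqxx; case: ifP.
Qed.

Lemma rel_bd2_cornerE x u :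
  rel_bd2_cell (inl x) u = (u == attaching_side x.1.1 x.1.2)%:R +
    (u == free_side x.1.1 x.2)%:R +
    if u is inl (inr c) then [exists b, arc_end c b == x]%:R else 0.
Proof.
rewrite -arc_cellsE; case: x => [[j b] r].
by rewrite -cell_sum2; apply: chainD.
Qed.

Lemma bd1_dual t p : bd1_cell t p = rel_bd2_cell p t.
Proof.
case: p => [[[j b] r]|v]; last first.
  apply: etrans (bd1_cellE _ _) _; apply: esym.
  apply: etrans (cell_sum2 _ _ _) _.
  case: t => [[[[i a]|[i s]]|c]|u]; [by []|by []|by []|].
  by rewrite eq_sym.
apply: etrans (bd1_cellE _ _) _; apply: esym.
apply: etrans (rel_bd2_cornerE _ _) _; apply: esym; set p := (j, b, r).
have ptE x : (inl p == corner_pt x) = (p == x) by [].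
case: t => [[[[i a]|[i s]]|c]|u]; rewrite ?ptE.
- have -> : (inl (inl (inl (i, a))) == free_side j r) = false by [].
  rewrite !addr0 -[_ == attaching_side _ _]/((i, a) == (j, b)) /p !xpair_eqE ![_ == j]eq_sym.
  by case: (j == i); case: (a); case: (b); case: (r); rewrite /= ?addr0 ?add0r.
- have -> : (inl (inl (inr (i, s))) == attaching_side j b) = false by [].
  rewrite addr0 add0r -[_ == free_side _ _]/((i, s) == (j, r)) /p !xpair_eqE ![_ == j]eq_sym.
  by case: (j == i); case: (s); case: (b); case: (r); rewrite /= ?addr0 ?add0r.
- have -> : (inl (inr c) == attaching_side j b) = false by [].
  have -> : (inl (inr c) == free_side j r) = false by [].
  rewrite addr0 add0r; case: existsP => [[b' /eqP <-]|np].
    have e d : (arc_end c b' == arc_end c d) = (b' == d).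
      by apply/eqP/eqP => [/arc_end_inj[] //|->].
    by rewrite !e; case: (b'); rewrite /= ?addr0 ?add0r.
  case: eqP => [e|_]; first by case: np; exists false; rewrite e.
  case: eqP => [e|_]; first by case: np; exists true; rewrite e.
  by rewrite addr0.
- by rewrite [RHS]addr0.
Qed.

Lemma bd2_dual i t : bd2_cell i t = rel_bd1_cell t i.
Proof.
apply: etrans (chainD _ _ _) _.
apply: etrans (congr2 +%R (cell_sum2 _ _ _) (cell_sum2 _ _ _)) _.
case: t => [[[[k a]|[k s]]|c]|u].
- apply: etrans (esym (cellE k i)); set x := inl _.
  have e0 b : (x == free_side i b) = false by [].
  have e b : (x == attaching_side i b) = ((k, a) == (i, b)) by [].
  rewrite !e0 !e.
  rewrite !xpair_eqE [k == i]eq_sym !addr0.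
  by case: (i == k); case: (a); rewrite /= ?addr0 ?add0r.
- apply: etrans (esym (cellE k i)); set x := inl _.
  have e0 b : (x == attaching_side i b) = false by [].
  have e b : (x == free_side i b) = ((k, s) == (i, b)) by [].
  rewrite !e0 !e.
  rewrite !xpair_eqE [k == i]eq_sym !addr0 add0r.
  by case: (i == k); case: (s); rewrite /= ?addr0 ?add0r.
- by rewrite /= ffunE !addr0.
- by rewrite /= ffunE !addr0.
Qed.

Lemma bd1_bd2 b : bd1 (bd2 b) = 0.
Proof.
rewrite /bd2 lin_extE linear_sum big1 // => i _; rewrite linearZ.
apply/eqP; rewrite scaler_eq0; apply/orP; right; apply/eqP.
apply: etrans (linearD _ _ _) _.
apply: etrans (congr2 +%R (lin_ext_cell2 _ _ _) (lin_ext_cell2 _ _ _)) _.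
apply: etrans (congr1 (+%R _) (addrACA _ _ _ _)) _.
exact: chain_addxx.
Qed.

Lemma rel_bd1_bd2 p : rel_bd1 (rel_bd2 p) = 0.
Proof.
have adj z w : crossing (bd2 z) w = crossing z (rel_bd1 w).
  exact/crossing_adj/bd2_dual.
have adj' z w : crossing (bd1 z) w = crossing z (rel_bd2 w).
  exact/crossing_adj/bd1_dual.
apply/ffunP => i; rewrite ffunE -crossing_cell crossingC -adj -adj' bd1_bd2.
by rewrite /crossing big1 // => q _; rewrite ffunE mul0r.
Qed.

(* The crossing number descends to homology: see intersection_class. *)
Definition intersection (x : H1) (y : H1_rel) : F2 :=
  crossing (hrepr x) (hrepr y).

Lemma crossing_bd2 z w :
  z \in limg bd2 -> w \in lker rel_bd1 -> crossing z w = 0.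
Proof.
case/memv_imgP => b _ ->; rewrite memv_ker => /eqP w0.
rewrite (crossing_adj bd2_dual) [lin_ext _ w]w0.
by rewrite /crossing big1 // => i _; rewrite ffunE mulr0.
Qed.

Lemma crossing_rel_bd2 z w :
  z \in lker bd1 -> w \in limg rel_bd2 -> crossing z w = 0.
Proof.
rewrite memv_ker => /eqP z0 /memv_imgP[r _ ->].
rewrite -(crossing_adj bd1_dual) [lin_ext _ z]z0.
by rewrite /crossing big1 // => i _; rewrite ffunE mul0r.
Qed.

Lemma crossing_congr z z' w w' :
    z' \in lker bd1 -> w \in lker rel_bd1 ->
    z - z' \in limg bd2 -> w - w' \in limg rel_bd2 ->
  crossing z w = crossing z' w'.
Proof.
move=> z'0 w0 zz' ww'.
have -> : z = 1 *: (z - z') + z' by rewrite scale1r subrK.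
rewrite crossing_linear_l crossing_bd2 // mulr0 add0r.
have {1}-> : w = 1 *: (w - w') + w' by rewrite scale1r subrK.
by rewrite crossingC crossing_linear_l crossingC crossing_rel_bd2 // mulr0 add0r crossingC.
Qed.

Lemma intersection_class z (dz : z \in lker bd1) w (dw : w \in lker rel_bd1) :
  intersection (hclass bd2 dz) (hclass rel_bd2 dw) = crossing z w.
Proof. by apply: crossing_congr; rewrite ?hrepr_class ?hrepr_cycle. Qed.

Lemma intersection_linear_l a x x' y :
  intersection (a *: x + x') y = a * intersection x y + intersection x' y.
Proof.
rewrite /intersection -crossing_linear_l; apply: crossing_congr.
- by rewrite rpredD ?rpredZ ?hrepr_cycle.
- exact: hrepr_cycle.
- exact: hrepr_linear.
- by rewrite subrr mem0v.
Qed.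

Definition alpha (i : 'I_n) : chain cell1 :=
  cell (free_side i false) + cell (free_side i true).

Definition beta (i : 'I_n) : chain cell1 :=
  cell (attaching_side i false) + cell (attaching_side i true).

Fact alpha_cycle i : alpha i \in lker rel_bd1.
Proof.
rewrite memv_ker; apply/eqP.
by apply: etrans (lin_ext_cell2 _ _ _) _; apply: chain_addxx.
Qed.

Fact beta_cycle i : beta i \in lker rel_bd1.
Proof.
rewrite memv_ker; apply/eqP.
by apply: etrans (lin_ext_cell2 _ _ _) _; apply: chain_addxx.
Qed.

Definition alpha_class (i : 'I_n) : H1_rel := hclass rel_bd2 (alpha_cycle i).
Definition beta_class (i : 'I_n) : H1_rel := hclass rel_bd2 (beta_cycle i).

End PuncturedRibbonGraph.

(******************************************************************************)
(* The symplectic space V and the L-space                                     *)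
(******************************************************************************)

Definition V (n : nat) : vectType F2 := 'rV[F2]_(n + n).

Definition e_ (n : nat) (i : 'I_n) : V n := delta_mx 0 (lshift n i).
Definition f_ (n : nat) (i : 'I_n) : V n := delta_mx 0 (rshift n i).

(* The sign of the second term is irrelevant in characteristic 2. *)
Definition sform (n : nat) (u v : V n) : F2 :=
  \sum_(i < n) (u 0 (lshift n i) * v 0 (rshift n i) +
                u 0 (rshift n i) * v 0 (lshift n i)).

Definition isotropic (n : nat) (U : {vspace V n}) : Prop :=
  forall u v, u \in U -> v \in U -> sform u v = 0.

Definition lagrangian (n : nat) (U : {vspace V n}) : Prop :=
  isotropic U /\
  forall W : {vspace V n}, isotropic W -> (U <= W)%VS -> W = U.

Section SymplecticForm.
Variable n : nat.
Implicit Types (i j : 'I_n) (u v w : V n).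

Lemma sform_linear_l a u v w : sform (a *: u + v) w = a * sform u w + sform v w.
Proof.
rewrite /sform mulr_sumr -big_split; apply: eq_bigr => i _ /=.
by rewrite !mxE !mulrDl mulrDr !mulrA addrACA.
Qed.

Lemma sformC u v : sform u v = sform v u.
Proof.
by apply: eq_bigr => i _; rewrite addrC mulrC [X in _ + X]mulrC.
Qed.

Lemma sform_alternating u : sform u u = 0.
Proof.
by rewrite /sform big1 // => i _; rewrite [X in _ + X]mulrC F2_addxx.
Qed.

Lemma sform_ef i j : sform (e_ i) (f_ j) = (i == j)%:R.
Proof.
rewrite /sform (bigD1 i) //= big1 => [|k ki].
  rewrite !mxE /= !eqxx (inj_eq (@rshift_inj _ _)) eq_lrshift eq_rlshift.
  by rewrite mul1r mul0r !addr0.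
rewrite !mxE /= !(inj_eq (@rshift_inj _ _)) !(inj_eq (@lshift_inj _ _)).
by rewrite (negbTE ki) eq_rlshift !mul0r addr0.
Qed.

Lemma sform_ee i j : sform (e_ i) (e_ j) = 0.
Proof.
by rewrite /sform big1 // => k _; rewrite !mxE /= !eq_rlshift mulr0 mul0r addr0.
Qed.

Lemma sform_ff i j : sform (f_ i) (f_ j) = 0.
Proof.
by rewrite /sform big1 // => k _; rewrite !mxE /= !eq_lrshift mulr0 mul0r addr0.
Qed.

End SymplecticForm.

Section LSpace.
Variables (n : nat) (G : ribbon_graph n).

Definition phi_fun (x : H1 G) : V n :=
  \sum_(i < n) intersection x (alpha_class G i) *: e_ i +
  \sum_(i < n) intersection x (beta_class G i) *: f_ i.

Fact phi_fun_linear : linear phi_fun.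
Proof.
move=> a x y; rewrite /phi_fun.
have lin (c : 'I_n -> H1_rel G) (g : 'I_n -> V n) :
    \sum_(i < n) intersection (a *: x + y) (c i) *: g i =
    a *: (\sum_(i < n) intersection x (c i) *: g i) +
    \sum_(i < n) intersection y (c i) *: g i.
  rewrite scaler_sumr -big_split /=; apply: eq_bigr => i _.
  by rewrite intersection_linear_l scalerDl scalerA.
by rewrite (lin _ (@e_ n)) (lin _ (@f_ n)) scalerDr; apply: addrACA.
Qed.

HB.instance Definition _ := GRing.isSemilinear.Build _ _ _ _ phi_fun
  (GRing.semilinear_linear phi_fun_linear).

Definition phi : 'Hom(H1 G, V n) := linfun phi_fun.

Lemma phiE x : phi x = phi_fun x.
Proof. by rewrite lfunE. Qed.

Definition L_space : {vspace V n} := limg phi.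

End LSpace.

(* Main.v *)
From HB Require Import structures.
Require Import Defs.
From mathcomp Require Import all_boot all_order all_algebra.
From mathcomp Require Import ring.

Set Implicit Arguments.
Unset Strict Implicit.
Unset Printing Implicit Defensive.

Import GRing.Theory.
Local Open Scope ring_scope.

(* The coordinates x, y, w of an absolute cycle z on the attaching side, the
   free side and the arc at a corner satisfy x + y = w. Isotropy: the form is the sum
   over all corners of x y' + y x' = w w' + x x' + y y', and each side and each
   arc has exactly two ends. Maximality: by linear duality, an element of the
   orthogonal of L lies in L as soon as it is killed by every functional beta
   on V which, together with some functional nu on 0-chains, annihilates all
   (boundary of z, image of z). These equations say that nu is constant on arcs
   and affine on the corners of each ribbon; such a nu splits at every corner
   as a function of the attaching side plus a function of the free side, so it
   is itself a cycle, and beta is the pairing with the image of that cycle. *)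

(** Outside [U], the vector [v] has a nonzero component along the complement of [U]. Some coordinate
    detects it, and precomposing that coordinate with [\1 - projv U] kills [U]. *)
Lemma separating_functional (K : fieldType) (X : vectType K)
    (U : {vspace X}) (v : X) :
  v \notin U ->
  exists2 l : 'Hom(X, K^o), forall u, u \in U -> l u = 0 & l v != 0.
Proof.
move=> vU; set r := v - projv U v.
have r0 : r != 0.
  by apply: contra vU; rewrite subr_eq0 => /eqP ->; apply: memv_proj.
have [j rj] : exists j, coord (vbasis fullv) j r != 0.
  apply/existsP; rewrite -negb_forall; apply: contra r0 => /forallP r0.
  rewrite (coord_vbasis (memvf r)) big1 // => j _.
  by rewrite (eqP (r0 j)) scale0r.
exists (linfun (coord (vbasis fullv) j : X -> K^o) \o (\1 - projv U))%VF => [u uU|].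
  by rewrite !lfunE /= !lfunE /= !lfunE /= projv_id // subrr linear0.
by rewrite !lfunE /= !lfunE /= !lfunE.
Qed.

(** If [(0, v)] were not in the image of [x |-> (A x, B x)], a functional separating it from this
    image would restrict to the two factors as a pair [nu], [beta] with [beta v] nonzero. *)
Lemma solvable_of_dual (K : fieldType) (X Y Z : vectType K)
    (A : 'Hom(X, Y)) (B : 'Hom(X, Z)) (v : Z) :
  (forall (nu : 'Hom(Y, K^o)) (beta : 'Hom(Z, K^o)),
     (forall x, nu (A x) + beta (B x) = 0) -> beta v = 0) ->
  exists2 x, A x = 0 & B x = v.
Proof.
move=> H.
have lin_pair : linear (fun x => (A x, B x) : Y * Z).
  by move=> a x y; rewrite !linearP.
pose pairL := GRing.isSemilinear.Build _ _ _ _ _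
  (GRing.semilinear_linear lin_pair).
pose pairAB : {linear X -> (Y * Z)%type} := HB.pack (fun x => (A x, B x)) pairL.
have [/memv_imgP[x _]|] := boolP ((0, v) \in limg (linfun pairAB)).
  by rewrite lfunE /= => -[Ax Bx]; exists x.
case/separating_functional => l l0 /eqP[].
have lin1 : linear (fun y : Y => l (y, 0)).
  move=> a y y'; rewrite -linearP; congr (l _).
  by apply: injective_projections; rewrite /= ?scaler0 ?addr0.
have lin2 : linear (fun z : Z => l (0, z)).
  move=> a z z'; rewrite -linearP; congr (l _).
  by apply: injective_projections; rewrite /= ?scaler0 ?addr0.
pose l1 : {linear Y -> K^o} := HB.pack (fun y : Y => l (y, 0))
  (GRing.isSemilinear.Build _ _ _ _ _ (GRing.semilinear_linear lin1)).
pose l2 : {linear Z -> K^o} := HB.pack (fun z : Z => l (0, z))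
  (GRing.isSemilinear.Build _ _ _ _ _ (GRing.semilinear_linear lin2)).
have := H (linfun l1) (linfun l2); rewrite lfunE; apply=> x.
rewrite !lfunE /= -linearD; apply: etrans (l0 (A x, B x) _).
  by congr (l _); apply: injective_projections; rewrite /= ?addr0 ?add0r.
by apply/memv_imgP; exists x; rewrite ?memvf ?lfunE.
Qed.

Lemma F2_eqP (x y : F2) : x + y = 0 -> x = y.
Proof. by move=> xy0; rewrite -[x]addr0 -(F2_addxx y) addrA xy0 add0r. Qed.

Lemma crossingDr (T : finType) (z w w' : chain T) :
  crossing z (w + w') = crossing z w + crossing z w'.
Proof.
by rewrite /crossing -big_split; apply: eq_bigr => t _; rewrite chainD mulrDr.
Qed.

Lemma crossing_cell2 (T : finType) (z : chain T) t t' :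
  crossing z (cell t + cell t') = z t + z t'.
Proof. by rewrite crossingDr !crossing_cell. Qed.

Lemma sum_corner (n : nat) (M : nmodType) (F : corner n -> M) :
  \sum_x F x = \sum_i (F (i, true, true) + F (i, true, false) +
                       (F (i, false, true) + F (i, false, false))).
Proof.
transitivity (\sum_(p : 'I_n * bool) \sum_s F (p.1, p.2, s)).
  by rewrite pair_bigA; apply: eq_bigr => -[[i a] s].
transitivity (\sum_i \sum_a \sum_s F (i, a, s)).
  by rewrite [RHS]pair_bigA.
by apply: eq_bigr => i _; rewrite !big_bool.
Qed.

Section RibbonGraph.
Variables (n : nat) (G : ribbon_graph n).
Implicit Types (z : chain (cell1 G)).

(** Three 1-cells meet at a corner: by [arc_end_inj], only one arc ends there. *)
Lemma bd1_arc_end z (c : Defs.arc G) b :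
  bd1 G z (corner_pt G (arc_end c b)) =
    z (attaching_side G (arc_end c b).1.1 (arc_end c b).1.2) +
    z (free_side G (arc_end c b).1.1 (arc_end c b).2) + z (arc_side c).
Proof.
rewrite -crossing_cell /bd1 (crossing_adj (@bd1_dual n G)) lin_ext_cell.
case E: (arc_end c b) => [[i a] s] /=.
rewrite crossingDr crossing_cell2; congr (_ + _).
rewrite (big_pred1 c) ?crossing_cell // => d /=.
apply/existsP/eqP => [[b' /eqP e]|->]; last by exists b; rewrite E.
by have := arc_end_inj (etrans e (esym E)) => -[].
Qed.

Lemma bd1_isolated z v : bd1 G z (isolated_pt v) = 0.
Proof.
rewrite -crossing_cell /bd1 (crossing_adj (@bd1_dual n G)) lin_ext_cell.
by rewrite crossing_cell2 F2_addxx.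
Qed.

(** The map [phi] on the level of chains: the halves of [alpha] and [beta] are dual to the free and
    attaching sides. *)
Definition crossings z : V n :=
  \row_j match split j with
         | inl i => z (free_side G i false) + z (free_side G i true)
         | inr i => z (attaching_side G i false) + z (attaching_side G i true)
         end.

Lemma crossings_e z i : crossings z 0 (lshift n i) =
  z (free_side G i false) + z (free_side G i true).
Proof. by rewrite mxE (unsplitK (inl _)). Qed.

Lemma crossings_f z i : crossings z 0 (rshift n i) =
  z (attaching_side G i false) + z (attaching_side G i true).
Proof. by rewrite mxE (unsplitK (inr _)). Qed.

Lemma crossings_linear : linear crossings.
Proof.
move=> a z z'; apply/rowP => j; rewrite !mxE.
by case: (split j) => i; rewrite !ffunE mulrDr addrACA.
Qed.

HB.instance Definition _ := GRing.isSemilinear.Build _ _ _ _ crossings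
  (GRing.semilinear_linear crossings_linear).

Lemma eq_V (u v : V n) :
  (forall i, u 0 (lshift n i) = v 0 (lshift n i)) ->
  (forall i, u 0 (rshift n i) = v 0 (rshift n i)) -> u = v.
Proof.
move=> uv1 uv2; apply/rowP => j; rewrite -(splitK j).
by case: (split j) => i /=.
Qed.

Lemma V_decomp (u : V n) :
  u = \sum_i u 0 (lshift n i) *: e_ i + \sum_i u 0 (rshift n i) *: f_ i.
Proof. by rewrite {1}[u]row_sum_delta big_split_ord. Qed.

Lemma crossings_cell (t : cell1 G) :
  crossings (cell t) =
  match t with
  | inl (inl (inl (i, _))) => f_ i
  | inl (inl (inr (i, _))) => e_ i
  | _ => 0
  end.
Proof.
have free_free i s j r : cell (free_side G i s) (free_side G j r) =
    ((j == i) && (r == s))%:R by apply: cellE.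
have att_att i a j b : cell (attaching_side G i a) (attaching_side G j b) =
    ((j == i) && (b == a))%:R by apply: cellE.
have att_free i a j s : cell (attaching_side G i a) (free_side G j s) = 0.
  exact: cellE.
have free_att i a j s : cell (free_side G j s) (attaching_side G i a) = 0.
  exact: cellE.
case: t => [[[[i a]|[i s]]|c]|v].
- rewrite -[inl _]/(attaching_side G i a).
  apply: eq_V => j; rewrite ?(crossings_e, crossings_f) !mxE eqxx /=.
    by rewrite !att_free eq_lrshift addr0.
  rewrite !att_att (inj_eq (@rshift_inj _ _)).
  by case: a; case: (j == i); rewrite /= ?addr0 ?add0r.
- rewrite -[inl _]/(free_side G i s).
  apply: eq_V => j; rewrite ?(crossings_e, crossings_f) !mxE eqxx /=.
    rewrite !free_free (inj_eq (@lshift_inj _ _)).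
    by case: s; case: (j == i); rewrite /= ?addr0 ?add0r.
  by rewrite !free_att eq_rlshift addr0.
- by apply: eq_V => j; rewrite ?(crossings_e, crossings_f) !cellE !mxE addr0.
- by apply: eq_V => j; rewrite ?(crossings_e, crossings_f) !cellE !mxE addr0.
Qed.

Lemma phi_hclass z (dz : z \in lker (bd1 G)) :
  phi G (hclass (bd2 G) dz) = crossings z.
Proof.
rewrite phiE /phi_fun [RHS]V_decomp; congr (_ + _); apply: eq_bigr => i _.
  by rewrite intersection_class crossing_cell2 crossings_e.
by rewrite intersection_class crossing_cell2 crossings_f.
Qed.

Lemma hclass_hrepr (x : H1 G) : hclass (bd2 G) (hrepr_cycle x) = x.
Proof.
rewrite -[RHS]reprvK; congr (piv _ _); exact: val_inj.
Qed.

Lemma L_spaceP (v : V n) :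
  reflect (exists2 z, bd1 G z = 0 & crossings z = v) (v \in L_space G).
Proof.
apply: (iffP idP) => [/memv_imgP[x _ ->]|[z z0 <-]].
  exists (hrepr x); first by apply/eqP; rewrite -memv_ker hrepr_cycle.
  by rewrite -(phi_hclass (hrepr_cycle x)) hclass_hrepr.
have dz : z \in lker (bd1 G) by rewrite memv_ker z0.
by rewrite -(phi_hclass dz) memv_img ?memvf.
Qed.

Lemma L_space_isotropic : isotropic (L_space G).
Proof.
move=> _ _ /L_spaceP[z z0 <-] /L_spaceP[z' z'0 <-].
pose w (y : chain (cell1 G)) (x : corner n) :=
  y (attaching_side G x.1.1 x.1.2) + y (free_side G x.1.1 x.2).
have wE y (c : Defs.arc G) b : bd1 G y = 0 -> w y (arc_end c b) = y (arc_side c).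
  by move=> y0; apply: F2_eqP; rewrite -bd1_arc_end y0 ffunE.
transitivity (\sum_x w z x * w z' x).
  rewrite sum_corner; apply: eq_bigr => i _; rewrite !crossings_e !crossings_f /w /=.
  set x0 := z (attaching_side _ _ false); set x1 := z (attaching_side _ _ true).
  set y0 := z (free_side _ _ false); set y1 := z (free_side _ _ true).
  set x0' := z' (attaching_side _ _ false).
  set x1' := z' (attaching_side _ _ true).
  set y0' := z' (free_side _ _ false); set y1' := z' (free_side _ _ true).
  (* Each product in [d] occurs at two of the four corners of the ribbon. Adding [d + d], which is
     zero in characteristic 2, leaves an identity valid in any commutative ring. *)
  pose d := x0 * x0' + x1 * x1' + y0 * y0' + y1 * y1'.
  rewrite -[LHS]addr0 -(F2_addxx d) /d; ring.
(* Grouped by arcs, the corners come in pairs contributing the same product, so their terms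
   cancel. *)
rewrite (reindex (fun cb : Defs.arc G * bool => arc_end cb.1 cb.2)) /=; last first.
  exact/onW_bij/arc_end_bij.
rewrite -(pair_bigA _ (fun c b => w z (arc_end c b) * w z' (arc_end c b))) /=.
by rewrite big1 // => c _; rewrite big_bool !wE //; exact: F2_addxx.
Qed.

Lemma L_space_orthogonal (v : V n) :
  (forall u, u \in L_space G -> sform u v = 0) -> v \in L_space G.
Proof.
move=> vL; apply/L_spaceP.
have [|z z0] := @solvable_of_dual _ _ _ _ (bd1 G) (linfun crossings) v; last first.
  by rewrite lfunE => zv; exists z.
move=> nu beta H.
pose nuc x : F2 := nu (cell (corner_pt G x)).
have Hcell t : nu (bd1_cell t) + beta (crossings (cell t)) = 0.
  by have := H (cell t); rewrite /bd1 lin_ext_cell lfunE.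
have Hatt i a : nuc (i, a, false) + nuc (i, a, true) = beta (f_ i).
  have := Hcell (attaching_side G i a); rewrite crossings_cell linearD.
  exact: F2_eqP.
have Hfree i s : nuc (i, false, s) + nuc (i, true, s) = beta (e_ i).
  have := Hcell (free_side G i s); rewrite crossings_cell linearD.
  exact: F2_eqP.
have Harc (c : Defs.arc G) b : nuc (arc_end c b) = nuc (arc_end c false).
  have := Hcell (arc_side c); rewrite crossings_cell linear0 addr0 linearD.
  by move/F2_eqP => e; case: b; first exact: esym e.
(* By [Hatt], [nuc (i, a, s)] is [nuc (i, a, false)] plus [beta (f_ i)] when [s] is true. The first
   term goes to the attaching side, the second to the free side, and the value of [nuc] shared by
   its ends to each arc. The circles of isolated vertices have zero boundary and get 0. *)
pose z : chain (cell1 G) := [ffun t => match t with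
  | inl (inl (inl (i, a))) => nuc (i, a, false)
  | inl (inl (inr (i, s))) => if s then beta (f_ i) else 0
  | inl (inr c) => nuc (arc_end c false)
  | inr _ => 0
  end].
have z_att i a : z (attaching_side G i a) = nuc (i, a, false) by rewrite ffunE.
have z_free i s : z (free_side G i s) = if s then beta (f_ i) else 0.
  by rewrite ffunE.
have z_arc c : z (arc_side c) = nuc (arc_end c false) by rewrite ffunE.
have z0 : bd1 G z = 0.
  apply/ffunP => -[x|u]; rewrite [RHS]ffunE; last exact: bd1_isolated.
  have [inv _ invK] := arc_end_bij G; rewrite -(invK x) /=.
  apply: etrans (bd1_arc_end _ _ _) _; rewrite z_att z_free z_arc.
  rewrite -(Harc _ (inv x).2).
  case: (arc_end _ _) => [[i a] s] /=.
  case: s; last by rewrite addr0 F2_addxx.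
  by rewrite -(Hatt i a) addrA F2_addxx add0r F2_addxx.
(* The [e_ i] coordinate of [crossings z] is [beta (f_ i)] and its [f_ i] coordinate is
   [beta (e_ i)], so pairing it with [v] gives [beta v]. *)
apply: etrans _ (vL _ (introT (L_spaceP _) (ex_intro2 _ _ z z0 erefl))).
rewrite {1}(V_decomp v) linearD !linear_sum /sform -big_split.
apply: eq_bigr => i _; rewrite !linearZ crossings_e crossings_f !z_att !z_free.
rewrite add0r Hfree addrC; congr (_ + _); exact: mulrC.
Qed.

End RibbonGraph.

Theorem theorem3p4 (n : nat) (G : ribbon_graph n) (connG : connected G) :
  lagrangian (L_space G).
Proof.
split=> [|W isoW LW]; first exact: L_space_isotropic.
apply/eqP; rewrite eqEsubv LW andbT; apply/subvP => v vW.
(* An isotropic [W] containing the L-space is orthogonal to it, hence contained in it. *)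
by apply: L_space_orthogonal => u uL; apply: isoW => //; apply: (subvP LW).
Qed.
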